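(* If an edge-colored graph $G$ is minimally $2$-colored, then $G$ is either a PC cycle or a $2$-colored g-bowtie that contains no PC cycle.
   Context: All graphs are finite and simple, and have non-empty vertex set. An edge-colored graph is a graph together with an arbitrary (not necessarily proper) assignment of a color to each edge. For a vertex $v$ of an edge-colored graph $G$, the color degree $d^c_G(v)$ is the number of distinct colors appearing on the edges of $G$ incident with $v$, and $\delta^c(G)=\min\{d^c_G(v): v\in V(G)\}$. Subgraphs inherit the edge-coloring. An edge-colored graph $G$ is $2$-colored if $\delta^c(G)\ge 2$. It is minimally $2$-colored if $\delta^c(G)\ge 2$ but every proper subgraph $H$ of $G$ satisfies $\delta^c(H)<2$. An edge-colored graph is properly colored (PC) if no two adjacent edges have the same color; a PC cycle is a cycle that is properly colored. A generalized bowtie (g-bowtie) is an edge-colored graph obtained from two disjoint cycles by joining them by a path (one end of the path on each cycle, the path being otherwise disjoint from the cycles); the path is allowed to be empty, in which case the g-bowtie is obtained from two disjoint cycles by identifying one vertex of one cycle with one vertex of the other. *)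

(* Defs.v *)
From mathcomp Require Import all_boot.

Set Implicit Arguments.
Unset Strict Implicit.
Unset Printing Implicit Defensive.

(* Graphs live in an ambient finite type [T], so that subgraphs of a graph are
   graphs over the same [T] and inherit a coloring [col : {set T} -> C].
   An edge is the set of its two ends; the values of [col] outside
   [eset G] are irrelevant to everything below. *)

Record graph (T : finType) := Graph {
  vset : {set T};
  eset : {set {set T}};
  vset_neq0 : vset != set0;
  eset_proper : [forall f in eset, (f \subset vset) && (#|f| == 2)]
}.

Definition subgraph (T : finType) (H G : graph T) : bool :=
  (vset H \subset vset G) && (eset H \subset eset G).

Definition proper_subgraph (T : finType) (H G : graph T) : bool :=
  subgraph H G && ((vset H != vset G) || (eset H != eset G)).

Definition color_degree (T : finType) (C : eqType) (col : {set T} -> C)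
    (G : graph T) (v : T) : nat :=
  size (undup [seq col f | f : {set T} <- enum (eset G) & v \in f]).

(* The neutral element [#|eset G|] bounds every color degree, so, [vset G]
   being non-empty, this is the true minimum: see [min_color_degreeP]. *)
Definition min_color_degree (T : finType) (C : eqType) (col : {set T} -> C)
    (G : graph T) : nat :=
  \big[minn/#|eset G|]_(v in vset G) color_degree col G v.

Definition two_colored (T : finType) (C : eqType) (col : {set T} -> C)
    (G : graph T) : bool :=
  2 <= min_color_degree col G.

Definition minimally_two_colored (T : finType) (C : eqType)
    (col : {set T} -> C) (G : graph T) : Prop :=
  two_colored col G /\
  (forall H : graph T, proper_subgraph H G -> min_color_degree col H < 2).

Definition properly_colored (T : finType) (C : eqType) (col : {set T} -> C)
    (G : graph T) : Prop :=
  forall f g : {set T}, f \in eset G -> g \in eset G ->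
    f != g -> f :&: g != set0 -> col f != col g.

(* [path_edges [:: x0; ...; xk]] consists of the {x_i, x_{i+1}}, i < k. *)
Definition path_edges (T : finType) (s : seq T) : {set {set T}} :=
  [set [set u.1; u.2] | u in zip s (behead s)].

(* As [path_edges], with in addition the closing edge {x_k, x_0}. *)
Definition cycle_edges (T : finType) (s : seq T) : {set {set T}} :=
  [set [set u.1; u.2] | u in zip s (rot 1 s)].

Definition is_cycle (T : finType) (G : graph T) : Prop :=
  exists s : seq T,
    [/\ 3 <= size s, uniq s, vset G = [set x in s] & eset G = cycle_edges s].

Definition is_PC_cycle (T : finType) (C : eqType) (col : {set T} -> C)
    (G : graph T) : Prop :=
  is_cycle G /\ properly_colored col G.

Definition contains_PC_cycle (T : finType) (C : eqType) (col : {set T} -> C)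
    (G : graph T) : Prop :=
  exists H : graph T, subgraph H G /\ is_PC_cycle col H.

(* [x :: p] lists the vertices of the joining path; it is the empty path when
   [p = [::]], and then the two cycles share exactly the vertex [x]. *)
Definition is_gbowtie (T : finType) (G : graph T) : Prop :=
  exists (C1 C2 : graph T) (x : T) (p : seq T),
    [/\ is_cycle C1 /\ is_cycle C2,
        vset C1 :&: vset C2 = (if nilp p then [set x] else set0),
        [/\ uniq (x :: p),
            vset C1 :&: [set z in x :: p] = [set x] &
            vset C2 :&: [set z in x :: p] = [set last x p]],
        vset G = vset C1 :|: vset C2 :|: [set z in x :: p] &
        eset G = eset C1 :|: eset C2 :|: path_edges (x :: p)].

Lemma color_degree_le (T : finType) (C : eqType) (col : {set T} -> C)
  (G : graph T) (v : T) : color_degree col G v <= #|eset G|.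
Proof.
apply: (leq_trans (size_undup _)).
by rewrite size_map size_filter cardE count_size.
Qed.

Lemma min_color_degreeP (T : finType) (C : eqType) (col : {set T} -> C)
    (G : graph T) (k : nat) :
  reflect (forall v, v \in vset G -> k <= color_degree col G v)
          (k <= min_color_degree col G).
Proof.
apply: (iffP idP) => [le_k v vG | le_k].
  apply: (leq_trans le_k); rewrite /min_color_degree.
  have: v \in index_enum T by rewrite mem_index_enum.
  elim: (index_enum T) => // w r IHr; rewrite in_cons big_cons.
  case/orP=> [/eqP <- | /IHr le_r]; first by rewrite vG geq_minl.
  by case: ifP => // _; rewrite geq_min le_r orbT.
have /set0Pn[v0 v0G] := vset_neq0 G.
rewrite /min_color_degree; elim/big_ind: _ => [|m n km kn|v vG].
- exact: leq_trans (le_k _ v0G) (color_degree_le _ _ _).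
- by rewrite leq_min km kn.
- exact: le_k.
Qed.

(* Main.v *)
Require Import Defs.
From mathcomp Require Import all_boot.

Set Implicit Arguments.
Unset Strict Implicit.
Unset Printing Implicit Defensive.

(** Any [2]-colored subgraph of a minimally [2]-colored graph [G] is [G] itself
    ([minimal_eq]).  Hence it suffices to find in [G] either a PC cycle, which
    is always [2]-colored ([PC_cycle_two_colored]), or a [2]-colored g-bowtie.

    Take a PC path [v_0 ... v_k] that can be prolonged to a longer PC path at
    neither end.  As [v_0] sees two colors, it has an edge [v_0 v_j] whose color
    is not that of [v_0 v_1], and [v_j] lies on the path because the path cannot
    be prolonged; symmetrically there is an edge [v_k v_i] whose color is not
    that of [v_(k-1) v_k] ([maximal_PC_path]).  In other words
    [v_j v_0 v_1 ... v_k v_i] is a walk in [G] whose consecutive edges have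
    distinct colors.

    If [j <= i], the edges of this walk form a g-bowtie: the cycles
    [v_0 ... v_j] and [v_i ... v_k] joined by the path [v_j ... v_i].  It is
    [2]-colored since every vertex is interior to the walk
    ([walk_two_colored]), so it is [G] ([gbowtie_of_walk]).

    If [i < j], the same edges form a theta graph with branch vertices [v_i] and
    [v_j], or the cycle [v_0 ... v_k] when [i = 0] and [j = k], and one of its
    cycles is PC ([theta_PC_cycle]).  Indeed, [v_0 ... v_j] fails to be PC only
    if [v_0 v_j] has the color of [v_(j-1) v_j], and [v_i ... v_k] only if
    [v_k v_i] has the color of [v_i v_(i+1)]; when both fail, the third cycle
    [v_i ... v_0 v_j ... v_k] is PC ([theta_colors]). *)

(** * Two-colored subgraphs of a minimally two-colored graph *)

Lemma two_coloredP (T : finType) (C : eqType) (col : {set T} -> C)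
    (G : graph T) :
  reflect (forall v, v \in vset G -> exists f g : {set T},
            [/\ f \in eset G, g \in eset G, v \in f, v \in g & col f != col g])
          (two_colored col G).
Proof.
apply: (iffP (min_color_degreeP col G 2)) => deg2 v vG.
  have := deg2 v vG; rewrite /color_degree; set s := map _ _.
  have := mem_undup s; have := undup_uniq s.
  case: (undup s) => [|a [|b r]] //= /andP[]; rewrite inE negb_or => /andP[ab _] _.
  move=> mem_s _.
  have /mapP[f] : a \in s by rewrite -mem_s mem_head.
  rewrite mem_filter mem_enum => /andP[vf fG] ea.
  have /mapP[g] : b \in s by rewrite -mem_s !inE eqxx orbT.
  rewrite mem_filter mem_enum => /andP[vg gG] eb.
  by exists f, g; split=> //; rewrite -ea -eb.
have [f [g [fG gG vf vg fg]]] := deg2 v vG.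
apply: (@uniq_leq_size _ [:: col f; col g]); first by rewrite /= inE fg.
move=> c; rewrite mem_undup !inE => /orP[] /eqP->; apply: map_f;
  by rewrite mem_filter mem_enum ?vf ?vg.
Qed.

Lemma edge_pair (T : finType) (G : graph T) (f : {set T}) (x : T) :
  f \in eset G -> x \in f -> exists2 z, z != x & f = [set x; z].
Proof.
move=> fG xf; have /forall_inP/(_ f fG)/andP[_ /cards2P[a [b [ab ef]]]] := eset_proper G.
move: xf; rewrite ef !inE => /orP[] /eqP->.
  by exists b; rewrite // eq_sym.
by exists a => //; rewrite setUC.
Qed.

Lemma minimal_eq (T : finType) (C : eqType) (col : {set T} -> C)
    (G H : graph T) :
  minimally_two_colored col G -> subgraph H G -> two_colored col H ->
  vset G = vset H /\ eset G = eset H.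
Proof.
move=> [_ minG] sHG cH.
have [/andP[/eqP-> /eqP->] //|ne] :=
  boolP ((vset H == vset G) && (eset H == eset G)).
have /minG : proper_subgraph H G by rewrite /proper_subgraph sHG -negb_and.
by rewrite ltnNge; move: cH; rewrite /two_colored => ->.
Qed.

(** A set of edges of [G] needs only to lie within [V] to be the edge set of a
    graph on [V]: that edges have two ends is inherited from [G]. *)
Lemma graph_on (T : finType) (G : graph T) (V : {set T}) (E : {set {set T}}) :
  V != set0 -> E \subset eset G -> (forall f, f \in E -> f \subset V) ->
  exists H : graph T, vset H = V /\ eset H = E.
Proof.
move=> V0 /subsetP sEG sEV.
have prE : [forall f in E, (f \subset V) && (#|f| == 2)].
  apply/forall_inP=> f fE; rewrite sEV //=.
  by case/andP: (forall_inP (eset_proper G) f (sEG f fE)).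
by exists (Graph V0 prE).
Qed.

(** The form of [minimal_eq] for subgraphs given by their vertices and edges.
    That [V] lies in [vset G] follows from every vertex of [V] having an edge
    in [E]. *)
Lemma minimal_spanned (T : finType) (C : eqType) (col : {set T} -> C)
    (G : graph T) (V : {set T}) (E : {set {set T}}) :
  minimally_two_colored col G -> V != set0 -> E \subset eset G ->
  (forall f, f \in E -> f \subset V) ->
  (forall v, v \in V -> exists f g : {set T},
     [/\ f \in E, g \in E, v \in f, v \in g & col f != col g]) ->
  vset G = V /\ eset G = E.
Proof.
move=> minG V0 sEG sEV cE.
have [H [VH EH]] := graph_on V0 sEG sEV.
rewrite -VH -EH in cE *; apply: minimal_eq minG _ (introT (two_coloredP _ _) cE).
apply/andP; split; last by rewrite EH.
apply/subsetP=> v /cE[f [_ [fH _ vf _ _]]].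
have fG : f \in eset G by apply: (subsetP sEG); rewrite -EH.
by case/andP: (forall_inP (eset_proper G) f fG) => /subsetP/(_ v vf).
Qed.

(** * Edge sequences of walks and closed walks *)

(** The edges of [path_edges s] in the order in which the walk [s] runs through
    them: being properly colored is then a property of consecutive items. *)
Definition steps (T : finType) (s : seq T) : seq {set T} :=
  [seq [set u.1; u.2] | u <- zip s (behead s)].

Definition closed_steps (T : finType) (s : seq T) : seq {set T} :=
  [seq [set u.1; u.2] | u <- zip s (rot 1 s)].

Lemma mem_path_edges (T : finType) (s : seq T) : path_edges s =i steps s.
Proof. by move=> f; apply/imsetP/mapP. Qed.

Lemma mem_cycle_edges (T : finType) (s : seq T) :
  cycle_edges s =i closed_steps s.
Proof. by move=> f; apply/imsetP/mapP. Qed.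

Lemma steps_cons2 (T : finType) (x y : T) (s : seq T) :
  steps [:: x, y & s] = [set x; y] :: steps (y :: s).
Proof. by []. Qed.

Lemma steps_cat (T : finType) (s1 : seq T) x (s2 : seq T) :
  steps (s1 ++ x :: s2) = steps (rcons s1 x) ++ steps (x :: s2).
Proof. by elim: s1 => //= a [|b s1] //= IHs; rewrite /steps /= in IHs *; rewrite IHs. Qed.

Lemma steps_rev (T : finType) (s : seq T) : steps (rev s) = rev (steps s).
Proof.
elim: s => [|x [|y s] IHs] //.
rewrite steps_cons2 2!(rev_cons (T := T)) -cats1 cat_rcons steps_cat -rev_cons IHs.
by rewrite rev_cons -cats1 (setUC [set x]).
Qed.

Lemma steps_rcons (T : finType) x (p : seq T) y :
  steps (x :: rcons p y) = rcons (steps (x :: p)) [set last x p; y].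
Proof. by rewrite -rcons_cons lastI -cats1 cat_rcons steps_cat cats1. Qed.

Lemma steps_cat_last (T : finType) x (p q : seq T) :
  steps (x :: p ++ q) = steps (x :: p) ++ steps (last x p :: q).
Proof. by rewrite -cat_cons lastI cat_rcons steps_cat. Qed.

Lemma closed_stepsE (T : finType) x (p : seq T) :
  closed_steps (x :: p) = rcons (steps (x :: p)) [set last x p; x].
Proof.
rewrite -steps_rcons /closed_steps /steps rot1_cons; congr map.
transitivity (zip ((x :: p) ++ [:: x]) (rcons p x ++ [::])).
  by rewrite zip_cat ?size_rcons // cats0.
by rewrite cats0 cats1.
Qed.

Lemma steps_sub (T : finType) (s : seq T) f :
  f \in steps s -> f \subset [set x in s].
Proof.
elim: s => [|x [|y s] IHs] //.
rewrite steps_cons2 inE => /predU1P[->|/IHs/subsetP sfs].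
  by apply/subsetP=> z; rewrite !inE orbA => ->.
by apply/subsetP=> z /sfs; rewrite !inE => ->; rewrite orbT.
Qed.

Lemma closed_steps_sub (T : finType) (s : seq T) f :
  f \in closed_steps s -> f \subset [set x in s].
Proof.
case: s => // x p; rewrite closed_stepsE -steps_rcons => /steps_sub.
move=> /subset_trans; apply; apply/subsetP=> z.
by rewrite !inE mem_rcons inE orbA orbb.
Qed.

Lemma zip_rot (S T : Type) n (s : seq S) (t : seq T) :
  size s = size t -> zip (rot n s) (rot n t) = rot n (zip s t).
Proof.
move=> eq_st.
have zip_td : zip s t = zip (take n s) (take n t) ++ zip (drop n s) (drop n t).
  by rewrite -zip_cat ?cat_take_drop // !size_take eq_st.
have [le_n|lt_n] := leqP (size s) n.
  by rewrite !rot_oversize // ?size_zip -?eq_st ?minnn.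
rewrite zip_cat ?size_drop ?eq_st // zip_td.
have {5}-> : n = size (zip (take n s) (take n t)).
  by rewrite size_zip !size_takel ?minnn // -?eq_st ltnW.
by rewrite rot_size_cat.
Qed.

(** Lets any vertex of a cycle be taken as its first one. *)
Lemma closed_steps_rot (T : finType) n (s : seq T) :
  closed_steps (rot n s) = rot n (closed_steps s).
Proof. by rewrite /closed_steps rot_rot zip_rot ?size_rot // map_rot. Qed.

Lemma closed_steps_head (T : finType) (x y : T) (p : seq T) f :
  uniq [:: x, y & p] -> f \in closed_steps [:: x, y & p] -> x \in f ->
  f = [set x; y] \/ f = [set last y p; x].
Proof.
move=> /andP[xNp _]; rewrite closed_stepsE mem_rcons !inE /= -/(steps (y :: p)).
case/or3P=> [/eqP|/eqP|/steps_sub/subsetP sfp xf]; [by right|by left|].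
by have := sfp x xf; rewrite inE (negPf xNp).
Qed.

(** * Properly colored cycles *)

Definition neqr (C : eqType) : rel C := [rel a b | a != b].

Lemma rev_sorted_neqr (C : eqType) (l : seq C) :
  sorted (@neqr C) (rev l) = sorted (@neqr C) l.
Proof. by rewrite rev_sorted; apply: eq_sorted => a b; rewrite /neqr /= eq_sym. Qed.

Lemma PC_cycle_two_colored (T : finType) (C : eqType) (col : {set T} -> C)
    (G : graph T) : is_PC_cycle col G -> two_colored col G.
Proof.
move=> [[s [s_ge3 Us VG EG]] PC]; apply/two_coloredP=> v; rewrite VG inE.
case/rot_to=> i p rot_s.
have mE f : (f \in eset G) = (f \in closed_steps (v :: p)).
  by rewrite EG mem_cycle_edges -rot_s closed_steps_rot mem_rot.
move: s_ge3 Us; rewrite -(size_rot i) -(rot_uniq i) rot_s.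
case: p mE {rot_s} => [|y [|z p]] // mE _ /= /and3P[].
rewrite !inE !negb_or => /and3P[vy vz vp] /andP[yz yp] _.
exists [set v; y], [set last z p; v].
have fE : [set v; y] \in eset G by rewrite mE closed_stepsE mem_rcons !inE eqxx orbT.
have gE : [set last z p; v] \in eset G by rewrite mE closed_stepsE mem_rcons !inE eqxx.
split; rewrite ?inE ?eqxx ?orbT //; apply: PC => //.
  apply: contraTneq (set22 v y) => ->.
  rewrite !inE negb_or (eq_sym y v) vy andbT.
  by apply: contraTneq (mem_last z p) => <-; rewrite inE negb_or yz.
by apply/set0Pn; exists v; rewrite !inE !eqxx orbT.
Qed.

(** Two distinct edges of a cycle that meet are the two edges at a common vertex,
    hence are cyclically consecutive.  So a cyclically alternating closed walk
    on distinct vertices is a PC cycle, and minimality makes it all of [G]. *)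
Lemma minimal_PC_cycle (T : finType) (C : eqType) (col : {set T} -> C)
    (G : graph T) (s : seq T) :
  minimally_two_colored col G -> 3 <= size s -> uniq s ->
  {subset closed_steps s <= eset G} ->
  cycle (@neqr C) (map col (closed_steps s)) -> is_PC_cycle col G.
Proof.
move=> minG s_ge3 Us sG PCs.
have rotP v : v \in s -> exists f g : {set T},
    [/\ f \in cycle_edges s, g \in cycle_edges s, v \in f, v \in g & col f != col g] /\
    forall h, h \in cycle_edges s -> v \in h -> h = f \/ h = g.
  (* With [v] put first, its two edges are the first and the last one, which
     are consecutive in the cyclic order. *)
  case/rot_to=> i p rot_s.
  have mE f : (f \in cycle_edges s) = (f \in closed_steps (v :: p)).
    by rewrite mem_cycle_edges -rot_s closed_steps_rot mem_rot.
  move: s_ge3 Us PCs; rewrite -(size_rot i) -(rot_uniq i) -(rot_cycle i).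
  rewrite -map_rot -closed_steps_rot rot_s.
  case: p mE {rot_s} => [|y p] // mE _ Up PCp.
  exists [set v; y], [set last y p; v]; split=> [|h]; last first.
    by rewrite mE => hE /(closed_steps_head Up hE).
  rewrite !mE !closed_stepsE !mem_rcons !inE !eqxx !orbT; split=> //.
  move: PCp; rewrite closed_stepsE /= map_rcons rcons_path last_rcons /=.
  by rewrite eq_sym => /andP[].
have V0 : [set x in s] != set0.
  by case: s s_ge3 {Us sG PCs rotP} => // x s _; apply/set0Pn; exists x; rewrite inE mem_head.
have [|||VG EG] := @minimal_spanned _ _ col G [set x in s] (cycle_edges s) minG V0.
- by apply/subsetP=> f; rewrite mem_cycle_edges; apply: sG.
- by move=> f; rewrite mem_cycle_edges; apply: closed_steps_sub.
- by move=> v; rewrite inE => /rotP[f [g [fg _]]]; exists f, g.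
split; first by exists s.
move=> f g; rewrite EG => fE gE fg /set0Pn[v /setIP[vf vg]].
have /rotP[f0 [g0 [[_ _ _ _ fg0] fgP]]] : v \in s.
  move: fE; rewrite mem_cycle_edges => /closed_steps_sub/subsetP/(_ v vf).
  by rewrite inE.
have [ef|ef] := fgP f fE vf; have [eg|eg] := fgP g gE vg; subst=> //.
- by rewrite eqxx in fg.
- by rewrite eq_sym.
- by rewrite eqxx in fg.
Qed.

(** The vertex sequence of a cycle covering [G] has length [#|vset G|], which
    makes the search for it finite; the final case distinction is therefore
    constructive. *)
Lemma is_PC_cycle_dec (T : finType) (C : eqType) (col : {set T} -> C)
    (G : graph T) : decidable (is_PC_cycle col G).
Proof.
apply: (@decP _ ([exists s : #|vset G|.-tuple T,
  [&& 3 <= size s, uniq s, vset G == [set x in s] & eset G == cycle_edges s]] &&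
  [forall f in eset G, forall g in eset G,
    (f != g) ==> (f :&: g != set0) ==> (col f != col g)])).
apply: (iffP andP) => [[/existsP[s /and4P[s3 Us /eqP VG /eqP EG]] PC]|[[s [s3 Us VG EG]] PC]].
  split; first by exists s.
  move=> f g fG gG fg fg0.
  by have /forall_inP/(_ g gG)/implyP/(_ fg)/implyP/(_ fg0) := forall_inP PC f fG.
split.
  have sz : size s == #|vset G| by rewrite VG cardsE (card_uniqP Us).
  by apply/existsP; exists (Tuple sz); apply/and4P; split=> //; apply/eqP.
apply/forall_inP=> f fG; apply/forall_inP=> g gG; apply/implyP=> fg.
by apply/implyP; apply: PC.
Qed.

(** * A properly colored path maximal at both ends *)

(** The two edges at an interior position of the walk are consecutive.  The
    chords at both ends of a maximal path make all of its vertices interior. *)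
Lemma walk_two_colored (T : finType) (C : eqType) (col : {set T} -> C)
    (a b v : T) (s : seq T) :
  sorted (@neqr C) (map col (steps (a :: rcons s b))) -> v \in s ->
  exists f g : {set T},
    [/\ f \in steps (a :: rcons s b), g \in steps (a :: rcons s b),
        v \in f, v \in g & col f != col g].
Proof.
move=> PCs vs; case/splitPr: vs PCs => s1 s2.
rewrite rcons_cat rcons_cons -cat_cons lastI.
have -> : rcons s2 b = head b s2 :: behead (rcons s2 b) by case: s2.
set a' := last a s1; set b' := head b s2.
rewrite cat_rcons steps_cat !steps_cons2 map_cat !map_cons => /cat_sorted2[_].
move=> /andP[ne _]; exists [set a'; v], [set v; b'].
by split=> //; rewrite ?mem_cat !inE eqxx ?orbT.
Qed.

(** [take 1] selects the edge of the path at [x], if there is one, so that a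
    path with a single vertex needs no separate treatment. *)
Lemma new_color_edge (T : finType) (C : eqType) (col : {set T} -> C)
    (G : graph T) (x : T) (p : seq T) :
  two_colored col G -> x \in vset G ->
  exists2 z, [set z; x] \in eset G &
    path (@neqr C) (col [set z; x]) (map col (take 1 (steps (x :: p)))).
Proof.
move=> /two_coloredP cG /cG[f [g [fG gG xf xg fg]]].
have [h [hG xh hP]] : exists h, [/\ h \in eset G, x \in h &
    path (@neqr C) (col h) (map col (take 1 (steps (x :: p))))].
  case: p => [|y p]; first by exists f.
  rewrite steps_cons2 /= take0 /= /neqr /=.
  have [ef|nf] := eqVneq (col f) (col [set x; y]); last by exists f; rewrite nf.
  by exists g; split; rewrite // -ef eq_sym fg.
have [z _ eh] := edge_pair hG xh.
by exists z; rewrite (setUC [set z]) -eh.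
Qed.

Definition PC_path (T : finType) (C : eqType) (col : {set T} -> C)
    (G : graph T) (s : seq T) : Prop :=
  [/\ uniq s, {subset s <= vset G}, {subset steps s <= eset G} &
      sorted (@neqr C) (map col (steps s))].

Lemma PC_path_rev (T : finType) (C : eqType) (col : {set T} -> C)
    (G : graph T) (s : seq T) : PC_path col G s -> PC_path col G (rev s).
Proof.
case=> Us sV sE PC; split.
- by rewrite rev_uniq.
- by move=> v; rewrite mem_rev; apply: sV.
- by move=> f; rewrite steps_rev mem_rev; apply: sE.
by rewrite steps_rev map_rev rev_sorted_neqr.
Qed.

(** As [x] sees two colors, one of its edges differs in color from the first
    step; the two cases are those of its other end lying off or on the path. *)
Lemma PC_path_cons (T : finType) (C : eqType) (col : {set T} -> C)
    (G : graph T) (x : T) (p : seq T) :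
  two_colored col G -> PC_path col G (x :: p) ->
  (exists z, PC_path col G [:: z, x & p]) \/
  exists2 z, z \in x :: p & [set z; x] \in eset G /\
    sorted (@neqr C) (map col (steps [:: z, x & p])).
Proof.
move=> cG [Us sV sE PC].
have [z zE zP] := new_color_edge p cG (sV x (mem_head x p)).
have PCz : sorted (@neqr C) (map col (steps [:: z, x & p])).
  case: p zP PC {Us sV sE} => [|y p] //=.
  by rewrite take0 /= andbT => ->.
have [zs|zNs] := boolP (z \in x :: p); first by right; exists z.
left; exists z; split=> //; first by rewrite cons_uniq zNs.
  move=> v; rewrite inE => /predU1P[->|/sV //].
  have /forall_inP/(_ _ zE)/andP[/subsetP/(_ z) sub _] := eset_proper G.
  by apply: sub; rewrite !inE eqxx.
by move=> f; rewrite steps_cons2 inE => /predU1P[->|/sE].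
Qed.

(** Prolonging at both ends stops, as a path has at most [#|T|] vertices; the two
    edges that come back to the path are then attached to it as the first and
    last steps of a single walk. *)
Lemma maximal_PC_path (T : finType) (C : eqType) (col : {set T} -> C)
    (G : graph T) :
  two_colored col G ->
  exists (x : T) (p : seq T) (w1 w2 : T),
    [/\ uniq (x :: p), w1 \in x :: p, w2 \in x :: p,
        {subset steps (w1 :: x :: rcons p w2) <= eset G} &
        sorted (@neqr C) (map col (steps (w1 :: x :: rcons p w2)))].
Proof.
move=> cG; have /set0Pn[v vG] := vset_neq0 G.
have: PC_path col G [:: v].
  by split=> // u; rewrite inE => /eqP->.
have: 0 < size [:: v] by [].
have [n] := ubnP (#|T| - size [:: v]).
elim: n [:: v] => // n IHn s; rewrite ltnS => le_n s0 PCs.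
have grow s' : size s' = (size s).+1 -> PC_path col G s' ->
    exists (x : T) (p : seq T) (w1 w2 : T),
    [/\ uniq (x :: p), w1 \in x :: p, w2 \in x :: p,
        {subset steps (w1 :: x :: rcons p w2) <= eset G} &
        sorted (@neqr C) (map col (steps (w1 :: x :: rcons p w2)))].
  move=> sz PC'; apply: (IHn s') => //; rewrite ?sz //.
  have [/card_uniqP Us' _ _ _] := PC'; have := max_card (mem s').
  by rewrite Us' sz => lt; apply: leq_trans le_n; rewrite ltn_sub2l.
case: s s0 PCs grow {le_n IHn} => // x p _ PCs grow.
have [[z /grow]|[w1 w1s [w1E PC1]]] := PC_path_cons cG PCs; first exact.
have := PC_path_rev PCs.
rewrite lastI rev_rcons => /(PC_path_cons cG)[[z]|[w2]].
  by rewrite -rev_rcons -lastI -rev_rcons; apply: grow; rewrite size_rev size_rcons.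
rewrite -rev_rcons -lastI -rev_rcons mem_rev => w2s [w2E PC2].
exists x, p, w1, w2; case: (PCs) => Us sV sE PC; split=> //.
  move=> f; rewrite steps_cons2 inE => /predU1P[-> //|].
  by rewrite steps_rcons mem_rcons inE => /predU1P[->|/sE //]; rewrite setUC.
move: PC2; rewrite steps_rev map_rev rev_sorted_neqr.
(* A path without edges is excluded, since its chord would be a loop; otherwise
   the two colorings overlap in an edge of the path. *)
case: p w1s w2s w2E PC1 {grow PCs Us sV sE PC} => [|y p].
  rewrite !inE => /eqP-> /eqP->.
  have /forall_inP/(_ [set x; x]) := eset_proper G.
  by rewrite setUid cards1 andbF => h /h.
by move=> _ _ _ /= /andP[-> _].
Qed.

(** * Overlapping chords: a properly colored cycle in a theta graph *)

(** Here [l1], [m :: l2] and [l3] are the colors of the path from [v_0] to [v_i],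
    from [v_i] to [v_j] and from [v_j] to [v_k], while [b] and [c] are those of
    [v_j v_0] and [v_k v_i].  If the first two cycles fail to alternate, then
    [b = last m l2] and [c = m], so at both branch vertices the third cycle
    changes color just as the path does. *)
Lemma theta_colors (C : eqType) (b m c : C) (l1 l2 l3 : seq C) :
  path (@neqr C) b (rcons (l1 ++ m :: l2 ++ l3) c) ->
  [\/ cycle (@neqr C) (rcons (l1 ++ m :: l2) b),
      cycle (@neqr C) (rcons (m :: l2 ++ l3) c) |
      cycle (@neqr C) (rev l1 ++ b :: rcons l3 c)].
Proof.
have cyc_rcons l d : cycle (@neqr C) (rcons l d) = path (@neqr C) d (rcons l d).
  by rewrite -[in LHS]cats1 cycle_catC.
rewrite !cyc_rcons => PC.
have [eb|nb] := eqVneq (last m l2) b; last first.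
  apply: Or31; rewrite rcons_path last_cat /= {2}/neqr /= nb andbT.
  by move: PC; rewrite -cat_cons catA rcons_cat cat_path => /andP[].
have [ec|nc] := eqVneq c m; last first.
  apply: Or32; rewrite /= /neqr /= nc /=.
  by move: PC; rewrite rcons_cat cat_path /= => /and3P[].
apply: Or33; rewrite cycle_catC /= rcons_cat cat_path last_rcons -rev_cons.
apply/andP; split.
  move: PC; rewrite rcons_cat cat_path /= rcons_cat cat_path eb.
  by case/and4P.
rewrite -[path _ _ _]/(sorted _ (c :: rev (b :: l1))) -rev_rcons rev_sorted_neqr /= ec.
by rewrite rcons_path; move: PC; rewrite rcons_cat cat_path /= => /and3P[-> ->].
Qed.

Lemma walk_step (T : finType) (G : graph T) (s1 s2 : seq T) (a b : T) :
  {subset steps (s1 ++ [:: a, b & s2]) <= eset G} -> a != b.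
Proof.
rewrite steps_cat steps_cons2 => /(_ [set a; b]).
rewrite mem_cat mem_head orbT => /(_ isT) abG.
have /forall_inP/(_ _ abG)/andP[_] := eset_proper G.
by rewrite cards2; case: (a != b).
Qed.

(** A walk whose consecutive edges have distinct colors never turns back along
    an edge.  This gives the lower bounds on cycle lengths. *)
Lemma walk_turn (T : finType) (C : eqType) (col : {set T} -> C)
    (s1 s2 : seq T) (a b c : T) :
  sorted (@neqr C) (map col (steps (s1 ++ [:: a, b, c & s2]))) -> a != c.
Proof.
rewrite steps_cat !steps_cons2 map_cat !map_cons => /cat_sorted2[_] /andP[].
by move=> ne _; apply: contraNneq ne => ->; rewrite setUC.
Qed.

Lemma closed_steps_rcons (T : finType) (s : seq T) (z : T) :
  closed_steps (rcons s z) = rcons (steps (rcons s z)) [set z; head z s].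
Proof. by case: s => [|x s]; rewrite closed_stepsE ?last_rcons. Qed.

(** In the notation of the opening comment, [w1 = v_j] and [w2 = v_i]; [A], [B1]
    and [B2] are what these two vertices leave of the path. *)
Lemma theta_PC_cycle (T : finType) (C : eqType) (col : {set T} -> C)
    (G : graph T) (w1 x w2 : T) (p A B1 B2 : seq T) :
  minimally_two_colored col G -> uniq (x :: p) ->
  x :: p = A ++ w2 :: B1 ++ w1 :: B2 ->
  {subset steps (w1 :: x :: rcons p w2) <= eset G} ->
  sorted (@neqr C) (map col (steps (w1 :: x :: rcons p w2))) ->
  is_PC_cycle col G.
Proof.
move=> minG Up ep sE PC.
have Es : steps (x :: p) =
    steps (rcons A w2) ++ steps (w2 :: rcons B1 w1) ++ steps (w1 :: B2).
  by rewrite ep steps_cat -cat_cons steps_cat.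
have ex : head w2 A = x by case: A ep {Es} => [|a A] [].
have ey : last w1 B2 = last x p by rewrite -(last_cons x x) ep last_cat /= last_cat.
have Ew : steps (w1 :: x :: rcons p w2) =
    [set w1; x] :: rcons (steps (x :: p)) [set last x p; w2].
  by rewrite steps_cons2 steps_rcons.
have sub f : f \in steps (rcons A w2) ++ steps (w2 :: rcons B1 w1) ++ steps (w1 :: B2) ->
    f \in eset G.
  by move=> fs; apply: sE; rewrite Ew inE mem_rcons inE Es fs !orbT.
have E1 : [set w1; x] \in eset G by apply: sE; rewrite mem_head.
have E2 : [set last x p; w2] \in eset G.
  by apply: sE; rewrite Ew inE mem_rcons mem_head orbT.
have Um : uniq (A ++ (w2 :: B1) ++ w1 :: B2) by rewrite /= -ep.
have B1A : 0 < size A + size B1.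
  case: A B1 ep {Es ex sub Um} => [|a A] [|b B1] //= [ex ep].
  by move: PC; rewrite ex ep => /(@walk_turn _ _ _ [::]); rewrite eqxx.
have B1B2 : 0 < size B1 + size B2.
  case: B1 B2 ep {Es ey sub Um B1A} => [|b B1] [|b' B2] //= ep.
  move: PC; rewrite -rcons_cons ep rcons_cat /= -cat_cons.
  by move=> /walk_turn; rewrite eqxx.
have [m [l EM]] : exists m l, map col (steps (w2 :: rcons B1 w1)) = m :: l.
  by case: (B1) => [|b B]; eexists; eexists.
have mid : rcons (A ++ w2 :: B1) w1 = A ++ w2 :: rcons B1 w1.
  by rewrite rcons_cat.
have Ec1 : closed_steps (rcons (A ++ w2 :: B1) w1) =
    rcons (steps (rcons A w2) ++ steps (w2 :: rcons B1 w1)) [set w1; x].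
  by rewrite closed_steps_rcons mid steps_cat; case: (A) ex => [|a A'] /= ->.
have Ec2 : closed_steps (w2 :: B1 ++ w1 :: B2) =
    rcons (steps (w2 :: rcons B1 w1) ++ steps (w1 :: B2)) [set last x p; w2].
  by rewrite closed_stepsE last_cat -cat_cons steps_cat /= ey.
have Ec3 : closed_steps (rev (rcons A w2) ++ w1 :: B2) =
    rev (steps (rcons A w2)) ++ [set w1; x] ::
      rcons (steps (w1 :: B2)) [set last x p; w2].
  rewrite rev_rcons cat_cons closed_stepsE last_cat /= ey -cat_cons steps_cat.
  rewrite rcons_cons steps_rcons -rev_rcons steps_rev cat_rcons rcons_cat.
  by congr (_ ++ _ :: _); rewrite setUC -ex; case: (A) => // a A'; rewrite rev_cons last_rcons.
have := PC; rewrite Ew Es /= map_rcons !map_cat EM => /theta_colors[] cyc.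
- apply: (minimal_PC_cycle (s := rcons (A ++ w2 :: B1) w1)) minG _ _ _ _.
  + by rewrite size_rcons size_cat /= addnS.
  + by move: Um; rewrite -cat_rcons !catA cat_uniq rcons_cat => /and3P[].
  + move=> f; rewrite Ec1 mem_rcons inE => /predU1P[-> //|fs].
    by apply: sub; rewrite catA mem_cat fs.
  + by rewrite Ec1 map_rcons map_cat EM.
- apply: (minimal_PC_cycle (s := w2 :: B1 ++ w1 :: B2)) minG _ _ _ _.
  + by rewrite /= size_cat /= addnS.
  + by move: Um; rewrite cat_uniq => /and3P[].
  + move=> f; rewrite Ec2 mem_rcons inE => /predU1P[-> //|fs].
    by apply: sub; rewrite mem_cat fs orbT.
  + by rewrite Ec2 map_rcons map_cat EM.
apply: (minimal_PC_cycle (s := rev (rcons A w2) ++ w1 :: B2)) minG _ _ _ _.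
(* If [A] and [B2] were both empty, the two chords would be one and the same
   edge, and the third cycle could not alternate. *)
- rewrite size_cat size_rev size_rcons /= addSn addnS !ltnS.
  case: (A) (B2) ex ey cyc => [|a A'] [|b B] //=.
  by move=> <- <-; rewrite setUC /neqr /= eqxx.
- rewrite (@perm_uniq _ _ (rcons A w2 ++ w1 :: B2)); last first.
    by rewrite perm_cat2r perm_rev.
  apply: subseq_uniq Um; rewrite cat_rcons; apply: cat_subseq => //=.
  by rewrite eqxx suffix_subseq.
- move=> f; rewrite Ec3 mem_cat mem_rev inE mem_rcons inE.
  case/or4P=> [fs|/eqP-> //|/eqP-> //|fs]; apply: sub; by rewrite !mem_cat fs ?orbT.
by rewrite Ec3 map_cat map_cons map_rcons map_rev.
Qed.

(** * Disjoint chords: a generalized bowtie *)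

Lemma cycle_in (T : finType) (G : graph T) (s : seq T) :
  3 <= size s -> uniq s -> {subset closed_steps s <= eset G} ->
  exists H : graph T,
    [/\ is_cycle H, vset H = [set z in s] & eset H = cycle_edges s].
Proof.
move=> s3 Us sE.
have [||| H [VH EH]] := @graph_on _ G [set z in s] (cycle_edges s).
- by case: s s3 {Us sE} => // x s _; apply/set0Pn; exists x; rewrite inE mem_head.
- by apply/subsetP=> f; rewrite mem_cycle_edges; apply: sE.
- by move=> f; rewrite mem_cycle_edges; apply: closed_steps_sub.
by exists H; split=> //; exists s.
Qed.

(** In the notation of the opening comment, [w = v_j] and [last w q = v_i]; the
    joining path is [w :: q], which is empty in the sense of g-bowties exactly
    when [i = j]. *)
Lemma gbowtie_of_walk (T : finType) (C : eqType) (col : {set T} -> C)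
    (G : graph T) (w x : T) (p A q B : seq T) :
  minimally_two_colored col G -> uniq (x :: p) ->
  x :: p = A ++ w :: q ++ B ->
  {subset steps (w :: x :: rcons p (last w q)) <= eset G} ->
  sorted (@neqr C) (map col (steps (w :: x :: rcons p (last w q)))) ->
  is_gbowtie G.
Proof.
set l := last w q => minG Up ep sE PC.
have lq : l \in w :: q by apply: mem_last.
have Es : steps (x :: p) = steps (rcons A w) ++ steps (w :: q) ++ steps (l :: B).
  by rewrite ep steps_cat steps_cat_last.
have ex : head w A = x by case: A ep {Es} => [|a A] [].
have ey : last l B = last x p by rewrite -(last_cons x x) ep last_cat /= last_cat.
have Ew : steps (w :: x :: rcons p l) =
    [set w; x] :: rcons (steps (x :: p)) [set last x p; l].
  by rewrite steps_cons2 steps_rcons.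
have Ec1 : closed_steps (rcons A w) = rcons (steps (rcons A w)) [set w; x].
  by rewrite closed_steps_rcons ex.
have Ec2 : closed_steps (l :: B) = rcons (steps (l :: B)) [set last x p; l].
  by rewrite closed_stepsE ey.
have Up' := Up; rewrite ep in Up'.
have A2 : 1 < size A.
  case: A ep {Es ex Ec1 Up'} => [|a [|a' A]] //= [ex ep].
    by move: sE; rewrite ex => /(@walk_step _ _ [::]); rewrite eqxx.
  by move: PC; rewrite ex ep => /(@walk_turn _ _ _ [::]); rewrite eqxx.
have B2 : 1 < size B.
  move: PC sE; rewrite -rcons_cons ep -[w :: q ++ B]cat_cons (lastI w q) cat_rcons.
  case: B ep {Es ey Ec2 Up'} => [|b [|b' B]] //= _.
    by rewrite catA rcons_cat -cat_cons => _ /walk_step; rewrite eqxx.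
  by rewrite catA rcons_cat -cat_cons => /walk_turn; rewrite eqxx.
have [VG EG] : vset G = [set z in x :: p] /\
    eset G = [set f in steps (w :: x :: rcons p l)].
  apply: (minimal_spanned minG).
  - by apply/set0Pn; exists x; rewrite inE mem_head.
  - by apply/subsetP=> f; rewrite inE; apply: sE.
  - move=> f; rewrite inE => /steps_sub/subset_trans; apply.
    apply/subsetP=> z; rewrite -rcons_cons !in_set in_cons mem_rcons in_cons ep.
    case/or3P=> [/eqP->|/eqP->|//]; first by rewrite mem_cat mem_head orbT.
    by rewrite -cat_cons !mem_cat lq orbT.
  move=> v; rewrite inE => /(@walk_two_colored _ _ _ w l _ (x :: p) PC)[f [g [fE gE vf vg fg]]].
  by exists f, g; rewrite !inE.
have [||| C1 [cycC1 VC1 EC1]] := @cycle_in _ G (rcons A w).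
- by rewrite size_rcons.
- by move: Up'; rewrite -cat_rcons cat_uniq => /andP[].
- move=> f fs; apply: sE; move: fs; rewrite Ec1 Ew !(inE, mem_rcons) Es !mem_cat.
  by case/orP=> ->; rewrite ?orbT.
have [||| C2 [cycC2 VC2 EC2]] := @cycle_in _ G (l :: B).
- by [].
- by move: Up'; rewrite -[w :: q ++ B]cat_cons (lastI w q) cat_rcons catA cat_uniq => /and3P[].
- move=> f fs; apply: sE; move: fs; rewrite Ec2 Ew !(inE, mem_rcons) Es !mem_cat.
  by case/orP=> ->; rewrite ?orbT.
have disjA z : z \in A -> (z \notin w :: q) /\ (z \notin B).
  move=> zA; move: Up'; rewrite cat_uniq -cat_cons => /and3P[_ /hasPn AB _].
  have := contraL (AB z) zA.
  by rewrite mem_cat negb_or => /andP.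
have disjB z : z \in B -> z \notin w :: q.
  move=> zB; move: Up'; rewrite cat_uniq -cat_cons => /and3P[_ _].
  by rewrite cat_uniq => /and3P[_ /hasPn/(_ z zB)].
have Uwq : uniq (w :: q).
  by move: Up'; rewrite -cat_cons !cat_uniq => /and3P[_ _ /and3P[]].
exists C1, C2, w, q; split.
- by [].
- rewrite VC1 VC2; apply/setP=> z; rewrite !inE mem_rcons !in_cons.
  have -> : (z \in if nilp q then [set w] else set0) = nilp q && (z == w).
    by case: (nilp q); rewrite ?inE.
  have lw : (l == w) = nilp q.
    rewrite /l; case: (q) Uwq => [|a r] /=; first by rewrite eqxx.
    by case/andP=> wr _; apply: contraNF wr => /eqP {1}<-; apply: mem_last.
  have [zA|zNA] := boolP (z \in A); rewrite ?orbT ?orbF /=.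
    have [zq zB] := disjA z zA; rewrite (negPf zB) orbF.
    have /negPf-> : z != l by apply: contraNneq zq => ->.
    move: zq; rewrite inE negb_or => /andP[/negPf-> _].
    by rewrite andbF.
  have [->|_] := eqVneq z w; last by rewrite andbF.
  have /negPf-> : w \notin B by apply/negP=> /disjB; rewrite mem_head.
  by rewrite eq_sym lw orbF andbT.
- split=> //.
    rewrite VC1; apply/setP=> z; rewrite !inE mem_rcons inE.
    case: eqVneq => //= zw; apply/negP => /andP[/disjA[]].
    by rewrite inE (negPf zw) /= => /negPf->.
  rewrite VC2; apply/setP=> z; rewrite in_setI in_set1 !in_set in_cons.
  case: eqVneq => [->|zl] //=.
  by apply/negP=> /andP[/disjB/negPf->].
- rewrite VG VC1 VC2; apply/setP=> z; rewrite !(in_set, in_setU) ep mem_rcons.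
  rewrite -[w :: q ++ B]cat_cons !mem_cat !in_cons.
  have := lq; rewrite in_cons; case: (eqVneq z l) => [-> ->|_ _]; first by rewrite !orbT.
  by case: (z \in A); case: (z == w); case: (z \in B); case: (z \in q).
rewrite EG EC1 EC2; apply/setP=> f.
rewrite in_set !in_setU !mem_cycle_edges mem_path_edges Ec1 Ec2 Ew Es.
rewrite in_cons !mem_rcons !in_cons !mem_cat.
by case: (f == _); case: (f == _); do 3!case: (f \in steps _).
Qed.

(** * Minimally two-colored graphs *)

Theorem theorem1p2 (T : finType) (C : eqType) (col : {set T} -> C)
    (G : graph T) :
  minimally_two_colored col G ->
  is_PC_cycle col G \/
  [/\ two_colored col G, is_gbowtie G & ~ contains_PC_cycle col G].
Proof.
move=> minG; have [cG _] := minG.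
have [|notPC] := is_PC_cycle_dec col G; [by left|right; split=> //]; last first.
  case=> H [sHG PCH].
  have [VG EG] := minimal_eq minG sHG (PC_cycle_two_colored PCH).
  by apply: notPC; move: PCH; rewrite /is_PC_cycle /is_cycle /properly_colored VG EG.
(* Splitting at [w2] and locating [w1] decides whether [j <= i]. *)
have [x [p [w1 [w2 [Up w1s w2s sE PC]]]]] := maximal_PC_path cG.
case/splitPr ep: _ / w2s => [A B].
move: w1s; rewrite ep -cat_rcons mem_cat => /orP[w1A|w1B].
  case/splitPr eA: _ / w1A => [A1 q].
  have e2 : w2 = last w1 q by rewrite -(last_rcons w2 A w2) eA last_cat.
  rewrite e2 in sE PC; apply: gbowtie_of_walk minG Up _ sE PC.
  by rewrite ep -cat_rcons eA -catA.
case/splitPr eB: _ / w1B => [B1 B2].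
by case: notPC; apply: theta_PC_cycle minG Up _ sE PC; rewrite ep eB.
Qed.
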